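(* Consider a random variable $Y\in\mathbb{N}^n$ with conditional distribution given $x\in(0,\infty)^n$ expressed as $$p_{Y|X}(Y=y|x)=\prod_{i=1}^n\frac{x_i^{y_i}}{y_i!}e^{-x_i},\qquad\forall y\in\mathbb{N}^n,$$ and let $p_X$ be any probability distribution for a multivariate positive random variable $X$ (i.e. with values in $(0,\infty)^n$). There is a (possibly nonconvex) proper penalty function $\tilde\varphi_X:\mathbb{R}^n\to\mathbb{R}\cup\{+\infty\}$ such that the minimum mean square error (MMSE) estimator of the (entrywise) logarithm $\log X=(\log X_i)_{i=1}^n$ satisfies, for any $y\in\mathbb{N}^n$, $$\mathbb{E}(\log X|Y=y)\in\arg\min_{\xi\in\mathbb{R}^n}\left\{\tfrac12\|y-\xi\|^2+\tilde\varphi_X(\xi)\right\}.\qquad( * )$$ The penalty $\tilde\varphi_X$ depends on the probability distribution $p_X$ of $X$. Further, if $\log X$ is non-degenerate then the function $y\mapsto\mathbb{E}(\log X|Y=y)$ is injective and there is a choice of $\tilde\varphi_X$ such that for any $y$, $\mathbb{E}(\log X|Y=y)$ is the unique stationary point (and global minimizer) of the function $\xi\mapsto\frac12\|y-\xi\|^2+\tilde\varphi_X(\xi)$ minimized in $( * )$; hence $y\mapsto\mathbb{E}(\log X|Y=y)$ is the proximity operator of $\tilde\varphi_X$.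
   Context: $\mathbb{N}=\{0,1,2,\dots\}$ and $\|\cdot\|$ is the Euclidean norm. The MMSE estimator is the conditional expectation: with $q(y|x):=\prod_{i=1}^n\frac{x_i^{y_i}}{y_i!}e^{-x_i}$, $$\mathbb{E}(\log X|Y=y)=\frac{\mathbb{E}_X\left(\log X\cdot q(y|X)\right)}{\mathbb{E}_X\left(q(y|X)\right)}.$$ A random variable $V$ with values in $\mathbb{R}^n$ and probability distribution $P$ is non-degenerate if there is no affine hyperplane containing $V$ almost surely, i.e. if $P(\langle V,v\rangle=d)<1$ for all nonzero $v\in\mathbb{R}^n$ and all $d\in\mathbb{R}$. A function with values in $\mathbb{R}\cup\{+\infty\}$ is proper if it is not identically $+\infty$. The proximity operator of a proper function $\varphi:\mathbb{R}^n\to\mathbb{R}\cup\{+\infty\}$ is the set-valued map $\mathrm{prox}_\varphi(y)=\arg\min_{\xi\in\mathbb{R}^n}\{\frac12\|y-\xi\|^2+\varphi(\xi)\}$; a function $f$ is the proximity operator of $\varphi$ (on its domain) when $\mathrm{prox}_\varphi(y)=\{f(y)\}$ for all $y$ in its domain, here $\mathbb{N}^n$. A point $u$ is a stationary point of $\varrho:\mathbb{R}^n\to\mathbb{R}\cup\{+\infty\}$ if $\nabla\varrho(u)=0$ (in which case $\varrho$ is finite on a neighborhood of $u$).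
   Formalization: ''For any y in N^n'' is read as: for every y at which E(log X|Y=y) is a vector of R^n (each log X_i·q(y|X) integrable), also for injectivity and prox; for some p_X an entry is −∞ when some y_i=0, e.g. n=1, y=0, X<1 with E(−log X)=+∞. *)

(* Defs.v *)
From HB Require Import structures.
From mathcomp Require Import all_boot all_order all_algebra.
From mathcomp Require Import all_classical all_reals all_analysis.

Set Implicit Arguments.
Unset Strict Implicit.
Unset Printing Implicit Defensive.
Import Order.TTheory GRing.Theory Num.Theory.
Import numFieldNormedType.Exports.

Local Open Scope classical_set_scope.
Local Open Scope ring_scope.

Definition dotp (R : realType) (n : nat) (u v : 'rV[R]_n) : R :=
  \sum_(i < n) u 0 i * v 0 i.

(* The library norm on 'rV[R]_n is the sup norm; only its (equivalent)
   topology is used below. *)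
Definition enorm (R : realType) (n : nat) (u : 'rV[R]_n) : R :=
  Num.sqrt (dotp u u).

Definition nat_row (R : realType) (n : nat) (y : 'rV[nat]_n) : 'rV[R]_n :=
  map_mx (fun k : nat => k%:R) y.

(* Points x of the sample space are tuples because n.-tuple R carries the
   product sigma-algebra; Euclidean vectors are rows. *)
Definition poisson_likelihood (R : realType) (n : nat)
    (y : 'rV[nat]_n) (x : n.-tuple R) : R :=
  \prod_(i < n) (tnth x i ^+ y 0 i / (y 0 i)`!%:R * expR (- tnth x i)).

Definition log_row (R : realType) (n : nat) (x : n.-tuple R) : 'rV[R]_n :=
  \row_i ln (tnth x i).

Definition positive_distribution (R : realType) (n : nat)
    (pX : probability (n.-tuple R) R) : Prop :=
  pX [set x : n.-tuple R | forall i, 0 < tnth x i] = 1%E.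

Definition nondegenerate_rv (d : measure_display) (T : measurableType d)
    (R : realType) (n : nat) (P : probability T R)
    (V : T -> 'rV[R]_n) : Prop :=
  forall (v : 'rV[R]_n) (c : R), v != 0 ->
    (P [set w | dotp (V w) v = c] < 1)%E.

(* The observations y at which E(log X | Y = y) exists as a vector of R^n.
   This holds at every y with positive entries, but can fail when y_i = 0 if
   the law of X_i puts too much mass near 0 (E(log X_i | Y = y) = -oo). *)
Definition mmse_domain (R : realType) (n : nat)
    (pX : probability (n.-tuple R) R) : set 'rV[nat]_n :=
  [set y | forall i : 'I_n, pX.-integrable setT
    (fun x : n.-tuple R => (log_row x 0 i * poisson_likelihood y x)%:E)].

Definition mmse (R : realType) (n : nat)
    (pX : probability (n.-tuple R) R) (y : 'rV[nat]_n) : 'rV[R]_n :=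
  \row_i (fine 'E_pX[fun x : n.-tuple R => log_row x 0 i * poisson_likelihood y x]
          / fine 'E_pX[poisson_likelihood y]).

Definition proper_penalty (R : realType) (n : nat)
    (phi : 'rV[R]_n -> \bar R) : Prop :=
  (forall xi, phi xi != -oo%E) /\ (exists xi, phi xi != +oo%E).

Definition argmin (R : realType) (T : Type) (F : T -> \bar R) : set T :=
  [set u | forall z, (F u <= F z)%E].

Definition prox_objective (R : realType) (n : nat) (phi : 'rV[R]_n -> \bar R)
    (y xi : 'rV[R]_n) : \bar R :=
  ((2^-1 * enorm (y - xi) ^+ 2)%:E + phi xi)%E.

Definition prox (R : realType) (n : nat) (phi : 'rV[R]_n -> \bar R)
    (y : 'rV[R]_n) : set 'rV[R]_n :=
  argmin (prox_objective phi y).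

Definition is_prox_operator (R : realType) (n : nat) (D : set 'rV[nat]_n)
    (f : 'rV[nat]_n -> 'rV[R]_n) (phi : 'rV[R]_n -> \bar R) : Prop :=
  forall y, D y -> prox phi (nat_row R y) = [set f y].

Definition gradient (R : realType) (n : nat) (f : 'rV[R]_n -> R)
    (u : 'rV[R]_n) : 'rV[R]_n :=
  \row_i 'D_(delta_mx 0 i) f u.

Definition stationary_points (R : realType) (n : nat)
    (rho : 'rV[R]_n -> \bar R) : set 'rV[R]_n :=
  [set u | [/\ \forall z \near u, rho z \is a fin_num,
               differentiable (fine \o rho) u &
               gradient (fine \o rho) u = 0]].

(* Main.v *)
(** The estimator f is a gradient of a convex function: with psi(y) the logarithm
    of y! E q(y|X) = E exp(<y, log X> - sum_i X_i), convexity of exp (Jensen under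
    the posterior given y) gives psi(y') - psi(y) >= <y' - y, f(y)>.  The conjugate
    of psi minus half the squared norm is then a penalty as required.
    If log X is non-degenerate, its posterior mean absolute deviation in every
    direction is bounded below by compactness of the unit sphere, and comparing
    exp with two of its tangents instead of one turns this into a gap at least
    linear in |y' - y|.  The gap makes the supremum of the <y, .> - psi(y) be
    attained only at y in a whole ball around f(y), so a penalty that is finite
    only on such balls, and affine on each of them, has no other stationary
    points. *)
Require Import Defs.
From HB Require Import structures.
From mathcomp Require Import all_boot all_order all_algebra.
From mathcomp Require Import all_classical all_reals all_analysis.
From mathcomp Require Import measurable_realfun ring lra.
Import Order.TTheory GRing.Theory Num.Theory.
Import numFieldNormedType.Exports.
Local Open Scope classical_set_scope.
Local Open Scope ring_scope.

Set Implicit Arguments.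
Unset Strict Implicit.
Unset Printing Implicit Defensive.

(** * Dot product of row vectors and its bound by the sup norm *)

Section dot_product.
Context {R : realType} {n : nat}.
Implicit Types u v w : 'rV[R]_n.

Lemma dotpC u v : dotp u v = dotp v u.
Proof. by apply: eq_bigr => i _; rewrite mulrC. Qed.

Lemma dotp_is_linear u : linear (dotp u).
Proof.
move=> k v w; rewrite /dotp scaler_sumr -big_split; apply: eq_bigr => i _ /=.
by rewrite !mxE mulrDr mulrCA.
Qed.

HB.instance Definition _ u :=
  GRing.isLinear.Build R 'rV[R]_n R _ (dotp u) (dotp_is_linear u).

Lemma dotpDl u v w : dotp (u + v) w = dotp u w + dotp v w.
Proof. by rewrite dotpC raddfD/= (dotpC w) (dotpC w v). Qed.

Lemma dotpBl u v w : dotp (u - v) w = dotp u w - dotp v w.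
Proof. by rewrite dotpC raddfB/= (dotpC w) (dotpC w v). Qed.

Lemma dotpBr u v w : dotp u (v - w) = dotp u v - dotp u w.
Proof. by rewrite raddfB. Qed.

Lemma dotpDr u v w : dotp u (v + w) = dotp u v + dotp u w.
Proof. by rewrite raddfD. Qed.

Lemma dotpZr k u v : dotp u (k *: v) = k * dotp u v.
Proof. by rewrite linearZ. Qed.

Lemma dotp_delta u i : dotp u (delta_mx 0 i) = u 0 i.
Proof.
rewrite /dotp (bigD1 i) //= mxE !eqxx mulr1 big1 ?addr0 // => j /negPf ji.
by rewrite mxE ji andbF mulr0.
Qed.

Lemma dotpvv_ge0 u : 0 <= dotp u u.
Proof. by apply: sumr_ge0 => i _; rewrite -expr2 sqr_ge0. Qed.

Lemma dotpvv_eq0 u : (dotp u u == 0) = (u == 0).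
Proof.
apply/eqP/eqP => [|->]; last by rewrite raddf0.
move/psumr_eq0P => u0; apply/rowP => i; apply/eqP; rewrite mxE -sqrf_eq0 expr2.
by apply/eqP/u0 => // j _; rewrite -expr2 sqr_ge0.
Qed.

Lemma enorm_sqr u : enorm u ^+ 2 = dotp u u.
Proof. by rewrite sqr_sqrtr// dotpvv_ge0. Qed.

Lemma normr_entry_le u i : `|u 0 i| <= `|u|.
Proof.
by rewrite [leRHS]/Num.norm/= mx_normrE; apply/bigmax_geP; right; exists (0, i).
Qed.

Lemma normr_rV_ge1 u i : 1 <= `|u 0 i| -> 1 <= `|u|.
Proof. by move=> /le_trans; apply; exact: normr_entry_le. Qed.

Lemma dotp_le u v : `|dotp u v| <= n%:R * (`|u| * `|v|).
Proof.
rewrite /dotp (le_trans (ler_norm_sum _ _ _))//.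
apply: (@le_trans _ _ (\sum_(i < n) `|u| * `|v|)).
  by apply: ler_sum => i _; rewrite normrM ler_pM// normr_entry_le.
by rewrite sumr_const card_ord -[leLHS]mulr_natl.
Qed.

End dot_product.

(** * Differentiability and gradients from quadratic remainders *)

Lemma is_diff_quadratic_remainder {R : realType} {V W : normedModType R}
    (f : V -> W) (df : {linear V -> W}) (u : V) (C : R) :
  continuous df ->
  (\forall x \near u, `|f x - (f u + df (x - u))| <= C * `|x - u| ^+ 2) ->
  is_diff u f df.
Proof.
move=> dfc fu.
have fo : f \o shift u = cst (f u) + df +o_ 0 id.
  apply/eqaddoP => _/posnumP[e]; rewrite near_simpl.
  (* For [h] below this radius, [C] times the squared norm of [h] is at most [e] times its norm; the
     [+ 1] keeps the denominator positive. *)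
  have e0 : 0 < e%:num / (`|C| + 1) by rewrite divr_gt0// ltr_wpDl.
  move: fu; rewrite (near_shift 0) subr0 => fu.
  near=> h.
  rewrite -[X in `|X|]/(f (h + u) - (f u + df h)).
  have : `|f (h + u) - (f u + df (h + u - u))| <= C * `|h + u - u| ^+ 2.
    by near: h; exact: fu.
  rewrite addrK => /le_trans; apply.
  rewrite expr2 mulrA ler_wpM2r//.
  apply: (@le_trans _ _ ((`|C| + 1) * `|h|)).
    by rewrite ler_wpM2r// (le_trans (ler_norm _))// lerDl.
  rewrite mulrC -ler_pdivlMr ?ltr_wpDl//.
have du := diff_unique dfc fo.
apply: DiffDef => //; apply/diff_locallyP; rewrite du; split => //.
Unshelve. all: by end_near. Qed.

Section quadratic_expansion.
Context {R : realType} {n : nat}.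
Implicit Types u g : 'rV[R]_n.

Lemma dotp_continuous u : continuous (dotp u).
Proof.
apply/linear_bounded_continuous/linear_boundedP; near=> r => v.
apply: (le_trans (dotp_le _ _)); rewrite mulrA.
apply: ler_wpM2r; first by [].
by near: r; apply: nbhs_pinfty_ge; rewrite num_real.
Unshelve. all: by end_near. Qed.

Lemma is_diff_quadratic (F : 'rV[R]_n -> R) u g :
  (\forall x \near u, F x = F u + dotp g (x - u) + 2^-1 * dotp (x - u) (x - u)) ->
  is_diff u F (dotp g).
Proof.
move=> Fu; apply: (@is_diff_quadratic_remainder R _ _ F (dotp g) u n%:R).
  exact: dotp_continuous.
apply: filterS Fu => x ->.
rewrite [X in `|X| <= _](_ : _ = 2^-1 * dotp (x - u) (x - u)); last by ring.
rewrite normrM ger0_norm ?invr_ge0//.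
apply: (@le_trans _ _ (1 * `|dotp (x - u) (x - u)|)).
  by rewrite ler_wpM2r// invf_le1// ler1n.
by rewrite mul1r expr2 dotp_le.
Qed.

Lemma gradient_quadratic (F : 'rV[R]_n -> R) u g :
  is_diff u F (dotp g) -> gradient F u = g.
Proof.
move=> [dF dFE]; apply/rowP => i; rewrite mxE deriveE// dFE.
exact: dotp_delta.
Qed.

End quadratic_expansion.

(** The exact Taylor expansion at [u] of x |-> <a, x> + |x - w|^2 / 2, whose gradient there is
    [a + (u - w)]. It is applied with [w] the centre [f y] of a ball. *)
Lemma dotp_quadratic_expansion {R : realType} {n : nat} (a w u x : 'rV[R]_n) :
  dotp a x = dotp a u + dotp (a + (u - w)) (x - u) +
    2^-1 * dotp (x - u) (x - u) + 2^-1 * dotp (u - w) (u - w)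
    - 2^-1 * dotp (x - w) (x - w).
Proof.
have -> : x - w = (x - u) + (u - w) by rewrite subrKA.
have -> : dotp a x = dotp a u + dotp a (x - u) by rewrite dotpBr; ring.
have dotp_sqrD (d e : 'rV[R]_n) :
    dotp (d + e) (d + e) = dotp d d + 2 * dotp e d + dotp e e.
  by rewrite dotpDl !dotpDr (dotpC d e); ring.
by rewrite (dotp_sqrD (x - u)) (dotpDl a (u - w)); field.
Qed.

(** * Penalties built from subgradient inequalities *)

Section penalties.
Context {R : realType} {n : nat}.
Variables (D : set 'rV[nat]_n) (f : 'rV[nat]_n -> 'rV[R]_n).
Variable psi : 'rV[nat]_n -> R.

Local Notation nr := (nat_row R).

Lemma prox_objectiveE (phi : 'rV[R]_n -> \bar R) (y xi : 'rV[R]_n) (t : R) :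
  phi xi = t%:E ->
  prox_objective phi y xi = (2^-1 * dotp (y - xi) (y - xi) + t)%:E.
Proof. by move=> phit; rewrite /prox_objective phit enorm_sqr EFinD. Qed.

Lemma half_dist_sqr (y xi : 'rV[R]_n) :
  2^-1 * dotp (y - xi) (y - xi) =
  2^-1 * dotp y y - dotp y xi + 2^-1 * dotp xi xi.
Proof. by rewrite dotpBr !dotpBl (dotpC xi y); field. Qed.

(* Fenchel conjugate of psi (restricted to D) minus the square norm: the
   subgradient inequality says that the supremum at f y is attained at y. *)
Lemma penalty_of_subgradient :
  (forall y y', D y -> D y' -> dotp (nr y' - nr y) (f y) <= psi y' - psi y) ->
  exists phi : 'rV[R]_n -> \bar R, proper_penalty phi /\
    (forall y, D y -> argmin (prox_objective phi (nr y)) (f y)).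
Proof.
(* Over an empty [D] the supremum below would be -oo everywhere, hence not proper; the zero penalty
   serves instead. *)
move=> subg; have [[y0 Dy0]|D0] := pselect (D !=set0); last first.
  exists (fun=> 0%E); split => [|y Dy]; last by case: D0; exists y.
  by split => //; exists 0.
pose h y xi := dotp (nr y) xi - psi y - 2^-1 * dotp xi xi.
pose phi xi := ereal_sup [set (h y xi)%:E | y in D].
have phi_ge y xi : D y -> ((h y xi)%:E <= phi xi)%E.
  by move=> Dy; apply: ereal_sup_ubound; exists y.
have phif y : D y -> phi (f y) = (h y (f y))%:E.
  move=> Dy; apply/eqP; rewrite eq_le phi_ge// andbT.
  apply: ge_ereal_sup => _ [y' Dy' <-]; rewrite lee_fin /h.
  by have := subg _ _ Dy Dy'; rewrite dotpBl; lra.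
exists phi; split; first split.
- by move=> xi; rewrite gt_eqF// (lt_le_trans _ (phi_ge _ xi Dy0))// ltNyr.
- by exists (f y0); rewrite phif.
- move=> y Dy xi; rewrite (prox_objectiveE _ (phif _ Dy)).
  rewrite (@le_trans _ _ (2^-1 * dotp (nr y - xi) (nr y - xi) + h y xi)%:E)//.
    by rewrite lee_fin !half_dist_sqr /h; lra.
  by rewrite EFinD /prox_objective enorm_sqr leeD2l// phi_ge.
Qed.

(** Distinct integers are at distance at least one. This separation excludes stationary points in
    the wrong ball and lets the tilting bound be applied to differences of observations. *)
Lemma nat_row_dist_ge1 (y y' : 'rV[nat]_n) : y != y' -> 1 <= `|nr y - nr y'|.
Proof.
move=> yy'.
have [i yi] : exists i, y 0 i != y' 0 i.
  apply/existsP; apply: contraNT yy'; rewrite negb_exists => /forallP yy'.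
  by apply/eqP/rowP => i; apply/eqP; have := yy' i; rewrite negbK.
apply: (@normr_rV_ge1 _ _ _ i); rewrite !mxE.
wlog ltyy' : y y' yi {yy'} / (y 0%R i < y' 0%R i)%N.
  move=> wl; move: (yi); rewrite neq_ltn => /orP[/wl|lt]; first exact.
  by rewrite distrC wl// eq_sym.
rewrite distrC -natrB ?(ltnW ltyy')// normr_nat ler1n subn_gt0//.
Qed.

Hypothesis gap : forall y, D y -> exists2 e : R, 0 < e &
  forall y', D y' -> y' != y ->
    dotp (nr y' - nr y) (f y) + e * `|nr y' - nr y| <= psi y' - psi y.

(** Moving from [f y] to [xi] changes <y' - y, .> by at most n |y' - y| |xi - f y|. The gap is also
    linear in |y' - y|, so it absorbs this change with a radius independent of [y']. *)
Lemma strict_subgradient_ball : exists r : 'rV[nat]_n -> R,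
  forall y, D y -> [/\ 0 < r y, r y <= 1 &
    forall y' xi, D y' -> y' != y -> `|xi - f y| < r y ->
      dotp (nr y') xi - psi y' < dotp (nr y) xi - psi y].
Proof.
have : forall y, exists r, D y -> [/\ 0 < r, r <= 1 &
    forall y' xi, D y' -> y' != y -> `|xi - f y| < r ->
      dotp (nr y') xi - psi y' < dotp (nr y) xi - psi y].
  move=> y; have [Dy|nDy] := pselect (D y); last by exists 0.
  have [e e0 He] := gap Dy.
  (* The factor [n] comes from [dotp_le], and [+ 1] covers n = 0. The cap 1 matches the minimal
     distance between distinct observations and is what rules out extra stationary points. *)
  exists (Num.min 1 (e / (n%:R + 1))) => _; split.
  - by rewrite lt_min ltr01 divr_gt0// ltr_wpDl.
  - by rewrite ge_min lexx.
  move=> y' xi Dy' y'y; rewrite lt_min => /andP[_ xie].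
  have := He _ Dy' y'y.
  have N1 := nat_row_dist_ge1 y'y.
  have := dotp_le (nr y' - nr y) (xi - f y); rewrite mulrCA ler_norml => /andP[_].
  have : `|nr y' - nr y| * (n%:R * `|xi - f y|) < `|nr y' - nr y| * e.
    rewrite ltr_pM2l ?(lt_le_trans ltr01)//.
    apply: (@le_lt_trans _ _ ((n%:R + 1) * `|xi - f y|)).
      by rewrite ler_wpM2r// lerDl.
    by rewrite mulrC -ltr_pdivlMr// ltr_wpDl.
  rewrite dotpBr !dotpBl; lra.
by move/choice => [r Hr]; exists r => y; exact: Hr.
Qed.

(** At a common value xi of [f], each of [y] and [y'] would strictly beat the other in <., xi> -
    psi. *)
Lemma inj_of_gap : set_inj D f.
Proof.
have [r Hr] := strict_subgradient_ball.
move=> y y' /set_mem Dy /set_mem Dy' fyy'; apply/eqP/negPn/negP => yy'.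
have [r0 _ H] := Hr _ Dy; have [r0' _ H'] := Hr _ Dy'.
have := H y' (f y) Dy'; rewrite eq_sym subrr normr0 => /(_ yy' r0).
have := H' y (f y) Dy; rewrite fyy' subrr normr0 => /(_ yy' r0').
by lra.
Qed.

(* The penalty is affine on small disjoint balls around the points f y, with
   slope chosen so that the objective has gradient y - f y + xi - y0 there,
   and +oo elsewhere. *)
Lemma penalty_of_gap : exists phi : 'rV[R]_n -> \bar R,
  [/\ proper_penalty phi,
      (forall y, D y ->
         stationary_points (prox_objective phi (nr y)) = [set f y] /\
         argmin (prox_objective phi (nr y)) (f y)) &
      is_prox_operator D f phi].
Proof.
have [D0|D0] := pselect (D !=set0); last first.
  exists (fun=> 0%E); split => [|y Dy|y Dy]; try by case: D0; exists y.
  by split => //; exists 0.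
have [r Hr] := strict_subgradient_ball.
(* The constant completes the square: on the ball of [y], the objective for [y0] becomes |y0|^2 / 2
   + <y - y0, xi> - psi y + |xi - f y|^2 / 2. *)
pose h y xi := dotp (nr y - f y) xi - psi y + 2^-1 * dotp (f y) (f y).
(* At most one index qualifies, so this is the infimum of a singleton or of the empty set; the
   latter gives +oo. *)
pose phi xi := ereal_inf [set (h y xi)%:E | y in
  [set y | D y /\ `|xi - f y| < r y]].
have phiE y xi : D y -> `|xi - f y| < r y -> phi xi = (h y xi)%:E.
  move=> Dy xiy; rewrite /phi (_ : mkset _ = [set y]) ?image_set1 ?ereal_inf1//.
  apply/seteqP; split => [y' [Dy' xiy']|_ ->//]; apply/eqP/negPn/negP => yy'.
  (* The balls are disjoint: at a common point each index would strictly beat the other. *)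
  have [_ _ H] := Hr _ Dy; have [_ _ H'] := Hr _ Dy'.
  have := H _ _ Dy' yy' xiy; rewrite eq_sym in yy'.
  by have := H' _ _ Dy yy' xiy'; lra.
have phioo xi : phi xi != +oo%E -> exists2 y, D y & `|xi - f y| < r y.
  move=> phixi; apply: contrapT => nxi; move: phixi; rewrite /phi.
  rewrite (_ : mkset _ = set0) ?image_set0 ?ereal_inf0 ?eqxx//.
  by apply/seteqP; split => // y [Dy xiy]; apply: nxi; exists y.
have rhoE y0 y xi : D y -> `|xi - f y| < r y ->
    prox_objective phi (nr y0) xi = (2^-1 * dotp (nr y0) (nr y0) +
      dotp (nr y - nr y0) xi - psi y +
      2^-1 * dotp (xi - f y) (xi - f y))%:E.
  move=> Dy xiy; rewrite (prox_objectiveE _ (phiE _ _ Dy xiy)) !half_dist_sqr.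
  by rewrite /h !dotpBl (dotpC xi); congr EFin; ring.
have fin_rho y0 xi : prox_objective phi (nr y0) xi != +oo%E ->
    phi xi != +oo%E.
  by apply: contraNN => /eqP E; rewrite /prox_objective E addey.
have center y : D y -> `|f y - f y| < r y.
  by move=> Dy; rewrite subrr normr0; have [] := Hr _ Dy.
have rho_min y y' xi : D y -> D y' -> `|xi - f y'| < r y' -> xi != f y ->
    (prox_objective phi (nr y) (f y) < prox_objective phi (nr y) xi)%E.
  move=> Dy Dy' xiy' xify; rewrite (rhoE _ _ _ Dy' xiy').
  rewrite (rhoE _ _ _ Dy (center _ Dy)) lte_fin !subrr raddf0 dotpC raddf0.
  have [y'y|y'y] := eqVneq y' y.
    rewrite y'y subrr dotpC raddf0.
    have : 0 < dotp (xi - f y) (xi - f y).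
      by rewrite lt_neqAle dotpvv_ge0 eq_sym dotpvv_eq0 subr_eq0 xify.
    by lra.
  (* In the ball of another [y'], <y' - y, xi> - psi y' exceeds - psi y, so the objective exceeds
     its value |y|^2 / 2 - psi y at [f y]. *)
  have [_ _ H] := Hr _ Dy'; rewrite eq_sym in y'y.
  have := H _ _ Dy y'y xiy'; have := dotpvv_ge0 (xi - f y').
  by rewrite !dotpBl; lra.
have rho_lt y xi : D y -> xi != f y ->
    (prox_objective phi (nr y) (f y) < prox_objective phi (nr y) xi)%E.
  move=> Dy xify.
  have [E|/fin_rho/phioo[y' Dy' xiy']] :=
    eqVneq (prox_objective phi (nr y) xi) +oo%E; last exact: (rho_min _ y').
  by rewrite E (rhoE _ _ _ Dy (center _ Dy)) ltry.
have argm y : D y -> argmin (prox_objective phi (nr y)) (f y).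
  move=> Dy xi; have [->//|xify] := eqVneq xi (f y).
  exact/ltW/rho_lt.
have near_ball y u : D y -> `|u - f y| < r y ->
    \forall x \near u, `|x - f y| < r y.
  move=> Dy uy; have : 0 < r y - `|u - f y| by rewrite subr_gt0.
  move=> e0; near=> x.
  rewrite -(subrK u x) -addrA (le_lt_trans (ler_normD _ _))//.
  rewrite -ltrBrDr distrC; near: x.
  by apply/nbhs_ballP; exists (r y - `|u - f y|) => //= x; rewrite -ball_normE.
have diff_rho y0 y u : D y -> `|u - f y| < r y ->
    is_diff u (fine \o prox_objective phi (nr y0))
      (dotp (nr y - nr y0 + (u - f y))).
  move=> Dy uy; apply: is_diff_quadratic.
  apply: filterS (near_ball _ _ Dy uy) => x xy.
  rewrite /= (rhoE _ _ _ Dy xy) (rhoE _ _ _ Dy uy) /=.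
  by rewrite (dotp_quadratic_expansion _ (f y) u x); ring.
exists phi; split.
- split => [xi|]; last by have [y Dy] := D0; exists (f y);
    rewrite (phiE _ _ Dy)//; exact: center.
  have [->//|/phioo[y Dy xiy]] := eqVneq (phi xi) +oo%E.
  by rewrite (phiE _ _ Dy xiy).
- move=> y Dy; split; last exact: argm.
  apply/seteqP; split => [u [/nbhs_singleton ufin udiff ugrad]|_ ->] /=.
  + have [y' Dy' uy'] : exists2 y', D y' & `|u - f y'| < r y'.
      by apply/phioo/(fin_rho y); move: ufin; rewrite fin_numE => /andP[].
    have := gradient_quadratic (diff_rho y _ _ Dy' uy').
    rewrite ugrad => /esym/eqP; rewrite addrC addr_eq0 opprB => /eqP uE.
    (* A zero gradient means u - f y' = y - y'. If [y] and [y'] differ, the right side has norm at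
       least 1, while [u] lies in an open ball of radius at most 1. *)
    have [yy'|/nat_row_dist_ge1] := eqVneq y y'.
      by apply/eqP; move/eqP: uE; rewrite yy' subrr subr_eq0.
    rewrite -uE => /le_lt_trans/(_ uy'); rewrite ltNge.
    by have [_ -> ] := Hr _ Dy'.
  + have dy := diff_rho y _ _ Dy (center _ Dy).
    split; last first.
    * by rewrite (gradient_quadratic dy) !subrr addr0.
    * by case: dy.
    * by apply: filterS (near_ball _ _ Dy (center _ Dy)) => x xy; rewrite (rhoE _ _ _ Dy).
- move=> y Dy; apply/seteqP; split => [u um|_ ->]; last exact: argm.
  apply/eqP/negPn/negP => /(rho_lt _ _ Dy); rewrite ltNge.
  by rewrite um.
Unshelve. all: by end_near. Qed.

End penalties.

(** * Seminorms on the unit sphere *)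

(** Expanding in the standard basis makes [a] Lipschitz, hence continuous; its minimum on the
    compact unit sphere is attained, and is positive by definiteness. *)
Lemma seminorm_lower_bound {R : realType} {n : nat} (a : 'rV[R]_n -> R) :
  (forall u v, a (u + v) <= a u + a v) ->
  (forall k u, a (k *: u) = `|k| * a u) ->
  (forall u, a u = 0 -> u = 0) ->
  exists2 c, 0 < c & forall u, `|u| = 1 -> c <= a u.
Proof.
move=> aD aZ a0.
have aN u : a (- u) = a u by rewrite -scaleN1r aZ normrN1 mul1r.
have az : a 0 = 0 by rewrite -(scale0r 0) aZ normr0 mul0r.
have age0 u : 0 <= a u by have := aD u (- u); rewrite subrr az aN; lra.
have a_sum (s : seq 'I_n) (F : 'I_n -> 'rV[R]_n) :
    a (\sum_(i <- s) F i) <= \sum_(i <- s) a (F i).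
  elim/big_rec2 : _ => [|i x y _ xy]; first by rewrite az.
  by rewrite (le_trans (aD _ _))// lerD2l.
pose C := \sum_(i < n) a (delta_mx 0 i).
have aC u : a u <= C * `|u|.
  rewrite [in a u](row_sum_delta u) (le_trans (a_sum _ _))// /C mulr_suml.
  by apply: ler_sum => i _; rewrite aZ mulrC ler_wpM2l// normr_entry_le.
have C0 : 0 <= C by exact: sumr_ge0.
have aB u v : `|a u - a v| <= C * `|u - v|.
  have := aD (u - v) v; rewrite subrK => auv.
  have := aD (v - u) u; rewrite subrK -opprB aN => avu.
  by rewrite (le_trans _ (aC _))// ler_norml; apply/andP; split; lra.
have ca : continuous a.
  move=> u; apply: (@cvgrPdist_le _ R^o _ (nbhs u) (nbhs_filter u) a (a u)).2 => e e0.
  have eC : 0 < e / (C + 1) by rewrite divr_gt0// ltr_wpDl.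
  apply: filterS (nbhsx_ballx u _ eC) => v; rewrite -ball_normE => /ltW uv.
  rewrite (le_trans (aB _ _))//.
  rewrite (@le_trans _ _ ((C + 1) * `|u - v|)) ?ler_wpM2r ?lerDl//.
  by rewrite mulrC -ler_pdivlMr ?ltr_wpDl.
pose S := [set u : 'rV[R]_n | `|u| = 1].
(* The sphere is empty when n = 0, and then any positive constant works. *)
have [[u0 Su0]|S0] := pselect (S !=set0); last first.
  by exists 1 => // u u1; case: S0; exists u.
have cS : compact S.
  apply: bounded_closed_compact.
    exists 1; split => // M M1 u /= ->; exact: ltW.
  rewrite (_ : S = (fun u : 'rV[R]_n => `|u|) @^-1` [set 1])//.
  apply: closed_comp => [u _|]; first exact: norm_continuous.
  exact: closed_eq.
have [|u /set_mem Su aS] := EVT_min_rV _ cS (continuous_subspaceT ca).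
  by exists u0.
exists (a u) => [|v Sv]; last by apply: aS; exact/mem_set.
rewrite lt_neqAle age0 andbT eq_sym; apply/negP => /eqP/a0 u00.
by move: Su; rewrite /S/= u00 normr0 => /eqP; rewrite eq_sym oner_eq0.
Qed.

(** * Lower bounds for the exponential *)

Section exponential_bounds.
Context {R : realType}.
Implicit Types c s t : R.

(* The tangent lines of expR at 0 (for t >= 0) and at - c (for t < 0). *)
Lemma expR_ge_two_tangents c t : 0 <= c ->
  t + (1 - expR (- c)) * ((`|t| - t) / 2) + expR (- c) * (1 + c) <= expR t.
Proof.
move=> c0; have [t0|t0] := leP 0 t.
  rewrite ger0_norm// subrr mul0r mulr0 addr0 (le_trans _ (expR_ge1Dx t))//.
  rewrite addrC lerD2r expRN mulrC ler_pdivrMr ?expR_gt0// mul1r.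
  exact: expR_ge1Dx.
rewrite ltr0_norm// [leLHS](_ : _ = expR (- c) * (1 + (t + c))); last by field.
have -> : expR t = expR (- c) * expR (t + c).
  by rewrite -expRD addrCA addNr addr0.
by rewrite ler_wpM2l ?expR_ge0// expR_ge1Dx.
Qed.

(** Bernoulli's inequality for the power [s] of exp t. It follows from exp((s - 1) t) >= 1 + (s - 1)
    t and t >= 1 - exp(- t), after multiplication by exp t. *)
Lemma expR_mul_ge s t : 1 <= s -> 1 + s * (expR t - 1) <= expR (s * t).
Proof.
move=> s1; rewrite [s * t](_ : _ = t + (s - 1) * t); last by ring.
have h1 : 1 - expR (- t) <= t by have := expR_ge1Dx (- t); lra.
have h2 := expR_ge1Dx ((s - 1) * t).
have h3 : 1 + (s - 1) * (1 - expR (- t)) <= expR ((s - 1) * t).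
  by rewrite (le_trans _ h2)// lerD2l ler_wpM2l// subr_ge0.
rewrite expRD (le_trans _ (ler_wpM2l (expR_ge0 t) h3))//.
rewrite [leRHS](_ : _ = expR t + (s - 1) * (expR t - expR t * expR (- t))); last by ring.
by rewrite -expRD subrr expR0 le_eqVlt; apply/orP; left; apply/eqP; ring.
Qed.

(** [c + expR (- c)] is the mean of the two-tangent bound when t has mean 0 and mean absolute value
    2c. It equals 1 at c = 0, which is the Jensen case. *)
Lemma mean_expR_factor_gt0 c : 0 <= c -> 0 < c + expR (- c).
Proof. by move=> c0; rewrite ltr_wpDl// expR_gt0. Qed.

Lemma mean_expR_factor_gt1 c : 0 < c -> 1 < c + expR (- c).
Proof.
by move=> c0; have := @expR_gt1Dx R (- c); rewrite oppr_eq0 gt_eqF// => /(_ isT); lra.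
Qed.

End exponential_bounds.

(** * Linearity of real integrals *)

Section real_integrals.
Context {d} {T : measurableType d} {R : realType}.
Variables (mu : {measure set T -> \bar R}) (A : set T).
Hypothesis mA : measurable A.
Local Notation integrable f := (mu.-integrable A (EFin \o f)).

Lemma integrable_scale k (f : T -> R) :
  integrable f -> integrable (fun x => k * f x).
Proof. exact: integrableZl. Qed.

Lemma integrable_add (f g : T -> R) :
  integrable f -> integrable g -> integrable (fun x => f x + g x).
Proof. exact: integrableD. Qed.

Lemma Rintegral_sum (I : Type) (s : seq I) (f : I -> T -> R) :
  (forall i, integrable (f i)) ->
  integrable (fun x => \sum_(i <- s) f i x) /\
  \int[mu]_(x in A) (\sum_(i <- s) f i x) =
    \sum_(i <- s) \int[mu]_(x in A) f i x.
Proof.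
move=> fi; elim: s => [|i s [IH1 IH2]].
  split; first by under eq_fun do rewrite big_nil; exact: integrable0.
  under eq_Rintegral do rewrite big_nil.
  by rewrite Rintegral_cst// mul0r big_nil.
split; first by under eq_fun do rewrite big_cons; exact: integrable_add.
under eq_Rintegral do rewrite big_cons.
by rewrite RintegralD// IH2 big_cons.
Qed.

End real_integrals.

(** * Exponential tilting of a weighted measure *)

Section exponential_tilting.
Context {d} {T : measurableType d} {R : realType} {n : nat}.
Variables (mu : {measure set T -> \bar R}) (A : set T).
Variables (q : T -> R) (U : T -> 'rV[R]_n).
Local Notation integrable f := (mu.-integrable A (EFin \o f)).
Hypothesis mA : measurable A.
Hypothesis q_gt0 : forall x, A x -> 0 < q x.
Hypothesis iq : integrable q.
Hypothesis iU : forall i, integrable (fun x => U x 0 i * q x).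

Local Notation Z := (\int[mu]_(x in A) q x).
Hypothesis Z_gt0 : 0 < Z.

Definition weighted_mean : 'rV[R]_n :=
  \row_i (\int[mu]_(x in A) (U x 0 i * q x) / Z).
Local Notation m := weighted_mean.

(** The mean absolute deviation in direction [v], not divided by the total weight [Z]; hence the
    factor [Z] in the bounds on it below. *)
Definition weighted_deviation (v : 'rV[R]_n) : R :=
  \int[mu]_(x in A) (`|dotp (U x - m) v| * q x).
Local Notation dev := weighted_deviation.

Lemma centered_integral v :
  integrable (fun x => dotp (U x - m) v * q x) /\
  \int[mu]_(x in A) (dotp (U x - m) v * q x) = 0.
Proof.
have ci i : integrable (fun x => v 0 i * ((U x - m) 0 i * q x)) /\
    \int[mu]_(x in A) (v 0 i * ((U x - m) 0 i * q x)) = 0.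
  have -> : (fun x => v 0 i * ((U x - m) 0 i * q x)) =
      (fun x => v 0 i * (U x 0 i * q x + (- m 0 i) * q x)).
    by apply/funext => x; rewrite !mxE mulrDl.
  have iB : integrable (fun x => U x 0 i * q x + (- m 0 i) * q x).
    by apply: integrable_add => //; exact: integrable_scale.
  split; first exact: integrable_scale.
  rewrite RintegralZl// RintegralD//; last exact: integrable_scale.
  by rewrite RintegralZl// mxE mulNr divfK ?subrr ?mulr0// gt_eqF.
have -> : (fun x => dotp (U x - m) v * q x) =
    (fun x => \sum_(i < n) v 0 i * ((U x - m) 0 i * q x)).
  apply/funext => x; rewrite /dotp mulr_suml; apply: eq_bigr => i _.
  by rewrite mulrAC mulrC.
have [i1 i2] := Rintegral_sum mA (index_enum 'I_n) (fun i => (ci i).1).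
by split => //; rewrite i2 big1// => i _; exact: (ci i).2.
Qed.

Lemma deviation_integrable v : integrable (fun x => `|dotp (U x - m) v| * q x).
Proof.
apply: eq_integrable (integrable_norm (centered_integral v).1) => // x /set_mem Ax.
by rewrite /= normrM (gtr0_norm (q_gt0 Ax)).
Qed.

(** With t the centred value of <U, v>, Bernoulli reduces the power [s] to exp t, and the two
    tangents bound exp t by an affine function of t and |t|. On integration the t term vanishes and
    the |t| term is controlled by the deviation. *)
Lemma tilted_integral_ge v c s : 0 <= c -> 1 <= s -> 2 * c * Z <= dev v ->
  integrable (fun x => expR (s * dotp (U x) v) * q x) ->
  Z * expR (s * dotp m v + s * ln (c + expR (- c))) <=
    \int[mu]_(x in A) (expR (s * dotp (U x) v) * q x).
Proof.
move=> c0 s1 cdev iexp.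
set L := c + expR (- c); have L0 : 0 < L by exact: mean_expR_factor_gt0.
set E := expR (- c); set K := expR _.
have E1 : E <= 1 by rewrite -expR0 ler_expR oppr_le0.
(* [k0], [k1] and [k2] are the coefficients of 1, t and |t| once the two-tangent bound is inserted
   into Bernoulli's inequality. *)
pose k0 := 1 - s + s * (E * (1 + c)) / L.
pose k1 := s / L * (1 - (1 - E) / 2).
pose k2 := s / L * ((1 - E) / 2).
have [iT T0] := centered_integral v.
have i1 : integrable (fun x => k1 * (dotp (U x - m) v * q x)).
  exact: integrable_scale.
have i2 : integrable (fun x => k2 * (`|dotp (U x - m) v| * q x)).
  by apply: integrable_scale => //; exact: deviation_integrable.
have i0 : integrable (fun x => k0 * q x) by exact: integrable_scale.
have i01 := integrable_add mA i0 i1.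
have i012 := integrable_add mA i01 i2.
apply: (@le_trans _ _ (K * (k0 * Z + k2 * dev v))).
  rewrite mulrC ler_wpM2l ?expR_ge0//.
  apply: (@le_trans _ _ (k0 * Z + k2 * (2 * c * Z))); last first.
    rewrite lerD2l ler_wpM2l// mulr_ge0 ?divr_ge0 ?(ltW L0)//; lra.
  rewrite le_eqVlt; apply/orP; left; apply/eqP.
  (* This identity is what dictates the value of [L]. *)
  suff : k0 + k2 * (2 * c) = 1 by move=> k; rewrite mulrA -mulrDl k mul1r.
  rewrite /k0 /k2.
  have -> : E = L - c by rewrite /L addrAC subrr add0r.
  by field; rewrite gt_eqF.
have -> : K * (k0 * Z + k2 * dev v) = \int[mu]_(x in A)
    (K * (k0 * q x + k1 * (dotp (U x - m) v * q x) +
          k2 * (`|dotp (U x - m) v| * q x))).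
  rewrite RintegralZl// RintegralD// RintegralD// !RintegralZl// ?T0 ?mulr0 ?addr0//.
  exact: deviation_integrable.
apply: le_Rintegral => //; first exact: integrable_scale.
move=> x Ax; set t := dotp (U x - m) v.
rewrite (_ : K * _ = K * (k0 + k1 * t + k2 * `|t|) * q x); last by ring.
rewrite ler_wpM2r ?(ltW (q_gt0 Ax))//.
(* Taking out [s * ln L] before applying Bernoulli makes the gain in the exponent linear in [s]. *)
have -> : s * dotp (U x) v = (s * dotp m v + s * ln L) + s * (t - ln L).
  by rewrite /t dotpBl; ring.
rewrite [leRHS]expRD ler_wpM2l ?expR_ge0//.
apply: le_trans (expR_mul_ge _ s1).
rewrite expRD expRN lnK ?posrE//.
have := expR_ge_two_tangents t c0; rewrite -/E -/L => tE.
rewrite (_ : k0 + _ + _ = 1 + s * ((t + (1 - E) * ((`|t| - t) / 2) +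
  E * (1 + c)) / L - 1)); last by rewrite /k0 /k1 /k2; field; rewrite gt_eqF.
by rewrite lerD2l ler_wpM2l ?(le_trans ler01)// lerD2r ler_wpM2r// invr_ge0 ltW.
Qed.

(** The previous bound in the unit direction of [v], with [s] the norm of [v]; this is where the
    norm must be at least 1. *)
Lemma tilted_integral_gap c : 0 <= c ->
  (forall v, `|v| = 1 -> 2 * c * Z <= dev v) ->
  forall v, 1 <= `|v| -> integrable (fun x => expR (dotp (U x) v) * q x) ->
  Z * expR (dotp m v + ln (c + expR (- c)) * `|v|) <=
    \int[mu]_(x in A) (expR (dotp (U x) v) * q x).
Proof.
move=> c0 cdev v v1 iv.
have v0 : `|v| != 0 by rewrite gt_eqF// (lt_le_trans ltr01).
have vE u : `|v| * dotp u (`|v|^-1 *: v) = dotp u v.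
  by rewrite dotpZr mulrA divff// mul1r.
have := @tilted_integral_ge (`|v|^-1 *: v) c `|v| c0 v1.
have -> : (fun x => expR (`|v| * dotp (U x) (`|v|^-1 *: v)) * q x) =
    (fun x => expR (dotp (U x) v) * q x) by apply/funext => x; rewrite vE.
rewrite vE (mulrC `|v| (ln _)); apply => //; apply: cdev.
by rewrite normrZ normfV normr_id mulVf.
Qed.

(** The deviation is a seminorm in [v]. If it vanished at a nonzero [v], <U, v> would equal <m, v>
    almost everywhere, so it is definite and compactness of the sphere applies. *)
Lemma weighted_deviation_lower_bound :
  (forall v k, v != 0 -> ~ ae_eq mu A (fun x => dotp (U x) v) (cst k)) ->
  exists2 c, 0 < c & forall v, `|v| = 1 -> 2 * c * Z <= dev v.
Proof.
move=> nondeg.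
have [|k u||c c0 Hc] := @seminorm_lower_bound R n dev.
- move=> u v; rewrite /dev -RintegralD//; try exact: deviation_integrable.
  apply: le_Rintegral => //; first exact: deviation_integrable.
    by apply: integrable_add => //; exact: deviation_integrable.
  move=> x Ax; rewrite -mulrDl ler_wpM2r ?(ltW (q_gt0 Ax))//.
  by rewrite dotpDr ler_normD.
- rewrite /dev -RintegralZl//; last exact: deviation_integrable.
  by apply: eq_Rintegral => x _; rewrite dotpZr normrM mulrA.
- move=> v dev0; apply/eqP/negPn/negP => v0.
  apply: (nondeg v (dotp m v) v0).
  have idev := deviation_integrable v.
  have /(ae_eq_integral_abs mu mA (measurable_int _ idev)) :
      (\int[mu]_(x in A) `|(`|dotp (U x - m) v| * q x)%:E| = 0)%E.
    transitivity (\int[mu]_(x in A) (`|dotp (U x - m) v| * q x)%:E)%E.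
      apply: eq_integral => x /set_mem Ax.
      by rewrite /= ger0_norm// mulr_ge0// ltW// q_gt0.
    by rewrite -[LHS]fineK ?integrable_fin_num//; congr EFin.
  apply: filterS => x + Ax => /(_ Ax)/= [].
  move/eqP; rewrite mulf_eq0 (gt_eqF (q_gt0 Ax)) orbF normr_eq0.
  by rewrite dotpBl subr_eq0 => /eqP.
exists (c / (2 * Z)); first by rewrite divr_gt0// mulr_gt0.
move=> v /Hc; congr (_ <= _); field; rewrite gt_eqF//.
Qed.

End exponential_tilting.

(** * The Poisson likelihood and its posterior *)

Section poisson.
Context {R : realType} {n : nat}.
Variable pX : probability (n.-tuple R) R.

(** Integrals are restricted to this set of full probability, where the logarithms are genuine and
    the likelihood is positive and at most 1. *)
Definition positive_orthant : set (n.-tuple R) :=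
  [set x | forall i, 0 < tnth x i].
Local Notation A := positive_orthant.
Hypothesis pA : pX A = 1%E.

Definition row_factorial (y : 'rV[nat]_n) : R := \prod_(i < n) (y 0%R i)`!%:R.

Definition poisson_normalizer (y : 'rV[nat]_n) : R :=
  \int[pX]_(x in A) poisson_likelihood y x.

Definition log_partition (y : 'rV[nat]_n) : R :=
  ln (row_factorial y * poisson_normalizer y).

Local Notation q := (@poisson_likelihood R n).
Local Notation U := (@log_row R n).
Local Notation Fy := row_factorial.
Local Notation Z := poisson_normalizer.

Lemma measurable_positive_orthant : measurable A.
Proof.
rewrite (_ : A = \bigcap_(i in [set: 'I_n]) ((@tnth n R ^~ i) @^-1` `]0, +oo[)).
  apply: fin_bigcap_measurable => // i _.
  by rewrite -[X in measurable X]setTI; apply: measurable_tnth.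
apply/seteqP; split => x Ax i; first by move=> _ /=; rewrite in_itv/= andbT.
by have := Ax i Logic.I; rewrite /= in_itv/= andbT.
Qed.
Local Notation mA := measurable_positive_orthant.

Lemma measurable_likelihood y : measurable_fun setT (q y).
Proof.
apply: measurable_prod => i _; apply: measurable_funM.
  apply: measurable_funM; last exact: measurable_cst.
  by apply: measurable_funX; exact: measurable_tnth.
apply: measurableT_comp => //; apply: measurableT_comp => //.
exact: measurable_tnth.
Qed.

Lemma measurable_log_row i : measurable_fun setT (fun x => U x 0 i).
Proof.
rewrite (_ : (fun _ => _) = @ln R \o (@tnth n R ^~ i)); last first.
  by apply/funext => x; rewrite mxE.
by apply: measurableT_comp => //; exact: measurable_tnth.
Qed.

Lemma Rintegral_setT_full (f : n.-tuple R -> R) : measurable_fun setT f ->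
  \int[pX]_(x in setT) f x = \int[pX]_(x in A) f x.
Proof.
move=> mf; rewrite [RHS]Rintegral_mkcond /Rintegral; congr fine.
apply: ae_eq_integral => //; first exact/measurable_EFinP.
  apply/measurable_EFinP; apply: (measurable_restrictT f mA).1.
  exact: measurable_funTS.
exists (~` A); split.
- exact: measurableC mA.
- by rewrite /= probability_setC ?pA ?subee//; exact: mA.
- move=> x /= nx Ax; apply: nx => _.
  by rewrite patchE mem_set.
Qed.

Lemma likelihood_gt0 y x : A x -> 0 < q y x.
Proof.
move=> Ax; apply: prodr_gt0 => i _.
by rewrite mulr_gt0 ?expR_gt0// divr_gt0 ?exprn_gt0 ?Ax// ltr0n fact_gt0.
Qed.

(** In each factor, a single term of the exponential series is at most the exponential. *)
Lemma likelihood_le1 y x : A x -> q y x <= 1.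
Proof.
move=> Ax; apply: Num.Theory.prodr_ile1 => i _.
have xi0 := Ax i.
rewrite mulr_ge0 ?expR_ge0 ?divr_ge0 ?exprn_ge0 ?(ltW xi0)//=.
rewrite expRN ler_pdivrMr ?expR_gt0// mul1r.
case: (y 0%R i) => [|k].
  by rewrite expr0 fact0 divr1 -expR0 ler_expR ltW.
by rewrite (le_trans _ (expR_ge1Dxn k (ltW xi0)))// lerDr.
Qed.

Lemma integrable_likelihood y : pX.-integrable A (EFin \o q y).
Proof.
apply: (measurable_bounded_integrable mA).
- by rewrite (@le_lt_trans _ _ 1%E) ?ltry// probability_le1//; exact: mA.
- by apply: measurable_funTS; exact: measurable_likelihood.
exists 1; split => // M M1 x Ax.
rewrite /= ger0_norm ?(ltW (likelihood_gt0 _ Ax))//.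
exact: le_trans (likelihood_le1 _ Ax) (ltW M1).
Qed.

Lemma row_factorial_gt0 y : 0 < Fy y.
Proof. by apply: prodr_gt0 => i _; rewrite ltr0n fact_gt0. Qed.

(** A positive function with zero integral would force the orthant to be null, against [pA]. *)
Lemma normalizer_gt0 y : 0 < Z y.
Proof.
have Z0 : 0 <= Z y.
  by apply: Rintegral_ge0 => x Ax; exact/ltW/likelihood_gt0.
rewrite lt_neqAle Z0 andbT eq_sym; apply/eqP => Zy0.
have iq := integrable_likelihood y.
have /(ae_eq_integral_abs pX mA (measurable_int _ iq)) [N [mN N0 AN]] :
    (\int[pX]_(x in A) `|(q y x)%:E| = 0)%E.
  transitivity (\int[pX]_(x in A) (q y x)%:E)%E.
    apply: eq_integral => x /set_mem Ax.
    by rewrite /= gtr0_norm// likelihood_gt0.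
  rewrite -[LHS]fineK; first by congr EFin.
  by rewrite integrable_fin_num//; exact: mA.
have : (pX A <= pX N)%E.
  apply: le_measure; rewrite ?inE//; first exact: mA.
  move=> x Ax; apply: AN => /= /(_ Ax)[] qx.
  by have := likelihood_gt0 y Ax; rewrite qx ltxx.
by rewrite [pX A]pA N0 lee_fin ler10.
Qed.

Lemma likelihood_expR y x : A x ->
  q y x * Fy y = expR (dotp (U x) (nat_row R y)) * \prod_(i < n) expR (- tnth x i).
Proof.
move=> Ax; rewrite /poisson_likelihood /row_factorial /dotp expR_sum -!big_split/=.
by apply: eq_bigr => i _; rewrite !mxE expRM_natr lnK ?posrE// mulrAC divfK.
Qed.

(** The exponential-family form: the factor exp(- sum x_i) does not depend on the observation and
    cancels. Tilting the posterior weight at [y] thus yields a multiple of the weight at [y'], which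
    is always integrable. *)
Lemma likelihood_ratio y y' x : A x ->
  expR (dotp (U x) (nat_row R y' - nat_row R y)) * q y x =
  Fy y' / Fy y * q y' x.
Proof.
move=> Ax; have F0 := lt0r_neq0 (row_factorial_gt0 y).
apply: (mulIf F0); rewrite -[LHS]mulrA (likelihood_expR _ Ax).
rewrite mulrA -expRD -dotpDr subrK -(likelihood_expR _ Ax).
by field.
Qed.

Section domain.
Variable y : 'rV[nat]_n.
Hypothesis Dy : mmse_domain pX y.

Lemma integrable_log_likelihood i :
  pX.-integrable A (EFin \o (fun x => U x 0 i * q y x)).
Proof.
apply: (integrableS measurableT mA _ (Dy i)) => //.
Qed.

Lemma mmse_weighted_mean : mmse pX y = weighted_mean pX A (q y) U.
Proof.
apply/rowP => i; rewrite !mxE; congr (_ / _); rewrite unlock.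
  apply: Rintegral_setT_full; apply: measurable_funM.
    exact: measurable_log_row.
  exact: measurable_likelihood.
by apply: Rintegral_setT_full; exact: measurable_likelihood.
Qed.

Lemma integrable_tilt y' : pX.-integrable A
  (EFin \o (fun x => expR (dotp (U x) (nat_row R y' - nat_row R y)) * q y x)).
Proof.
apply: (eq_integrable mA _ _ _
  (integrable_scale mA (Fy y' / Fy y) (integrable_likelihood y'))).
by move=> x /set_mem Ax /=; rewrite likelihood_ratio.
Qed.

(** The logarithm of the tilted bound with v = y' - y, since the tilted integral is the normalizer
    at [y'] up to factorials. Taking c = 0 gives the plain subgradient inequality, c > 0 the linear
    gap. *)
Lemma log_partition_gap c : 0 <= c ->
  (forall v, `|v| = 1 -> 2 * c * Z y <= weighted_deviation pX A (q y) U v) ->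
  forall y', y' != y ->
    dotp (nat_row R y' - nat_row R y) (mmse pX y) +
      ln (c + expR (- c)) * `|nat_row R y' - nat_row R y| <=
    log_partition y' - log_partition y.
Proof.
move=> c0 cdev y' /(@nat_row_dist_ge1 R) v1.
have := tilted_integral_gap mA (fun x => @likelihood_gt0 y x)
  (integrable_likelihood y) integrable_log_likelihood (normalizer_gt0 y) c0 cdev
  v1 (integrable_tilt y').
rewrite -mmse_weighted_mean dotpC.
have -> : \int[pX]_(x in A)
    (expR (dotp (U x) (nat_row R y' - nat_row R y)) * q y x) =
    Fy y' / Fy y * Z y'.
  rewrite /Z -RintegralZl; [|exact: mA|exact: integrable_likelihood].
  by apply: eq_Rintegral => x /set_mem Ax; rewrite likelihood_ratio.
have F0 := row_factorial_gt0 y; have F0' := row_factorial_gt0 y'.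
have Z0 := normalizer_gt0 y; have Z0' := normalizer_gt0 y'.
set t := (X in expR X); rewrite mulrAC ler_pdivlMr// mulrC mulrA => H.
rewrite lerBrDr addrC -[leLHS]/(log_partition y + t) /log_partition -[t]expRK.
by rewrite -lnM ?posrE ?mulr_gt0 ?expR_gt0// ler_ln// posrE !mulr_gt0 ?expR_gt0.
Qed.

(** Otherwise the orthant would lie in the preimage of a hyperplane up to a null set, giving that
    preimage probability one. *)
Lemma nondegenerate_not_ae_eq : nondegenerate_rv pX U ->
  forall v k, v != 0 -> ~ ae_eq pX A (fun x => dotp (U x) v) (cst k).
Proof.
move=> nondeg v k v0 [N [mN N0 AN]].
have := nondeg v k v0; rewrite ltNge; apply/negP/negPn.
set S := [set w | _].
have mS : measurable S.
  have mUv : measurable_fun setT (fun x => dotp (U x) v).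
    apply: measurable_sum => i; apply: measurable_funM => //.
    exact: measurable_log_row.
  by rewrite /S -[X in measurable X]setTI; exact: (mUv measurableT [set k]).
rewrite -[1%E]pA.
apply: (@le_trans _ _ (pX (S `|` N))).
  apply: le_measure; rewrite ?inE//; [exact: mA|exact: measurableU|].
  move=> x Ax; have [Sx|nSx] := pselect (S x); [by left|right].
  by apply: AN => /= /(_ Ax).
by rewrite measureU0.
Qed.

End domain.

End poisson.

Theorem proposition5 (R : realType) (n : nat)
    (pX : probability (n.-tuple R) R) (pX_pos : positive_distribution pX) :
  (exists phi : 'rV[R]_n -> \bar R,
     proper_penalty phi /\
     (forall y : 'rV[nat]_n, mmse_domain pX y ->
        argmin (prox_objective phi (nat_row R y)) (mmse pX y)))
  /\
  (nondegenerate_rv pX (@log_row R n) ->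
     set_inj (mmse_domain pX) (mmse pX) /\
     (exists phi : 'rV[R]_n -> \bar R,
        [/\ proper_penalty phi,
            (forall y : 'rV[nat]_n, mmse_domain pX y ->
               stationary_points (prox_objective phi (nat_row R y))
                 = [set mmse pX y] /\
               argmin (prox_objective phi (nat_row R y)) (mmse pX y)) &
            is_prox_operator (mmse_domain pX) (mmse pX) phi])).
Proof.
split.
  apply: (@penalty_of_subgradient _ _ _ _ (log_partition pX)) => y y' Dy Dy'.
  have [->|y'y] := eqVneq y' y; first by rewrite !subrr dotpC raddf0.
  (* With c = 0 both tangents are taken at 0, the deviation hypothesis is trivial and the gap term
     is ln 1 = 0. *)
  have dev_ge0 v : `|v| = 1 -> 2 * 0 * poisson_normalizer pX y <=
      weighted_deviation pX (@positive_orthant R n) (poisson_likelihood y) (@log_row R n) v.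
    move=> _; rewrite mulr0 mul0r; apply: Rintegral_ge0 => x Ax.
    by rewrite mulr_ge0// ltW// likelihood_gt0.
  have := log_partition_gap pX_pos Dy (lexx 0) dev_ge0 y'y.
  by rewrite oppr0 expR0 add0r ln1 mul0r addr0.
move=> nondeg.
have gap y : mmse_domain pX y -> exists2 e : R, 0 < e &
    forall y', mmse_domain pX y' -> y' != y ->
      dotp (nat_row R y' - nat_row R y) (mmse pX y) +
        e * `|nat_row R y' - nat_row R y| <=
      log_partition pX y' - log_partition pX y.
  move=> Dy.
  have [c c0 cdev] := weighted_deviation_lower_bound
    (@measurable_positive_orthant R n) (fun x => @likelihood_gt0 R n y x)
    (integrable_likelihood pX y) (integrable_log_likelihood Dy)
    (normalizer_gt0 pX_pos y) (nondegenerate_not_ae_eq pX_pos nondeg).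
  (* Since c > 0 the factor exceeds 1, so its logarithm is a positive rate. It depends on [y]
     through [c], but not on [y']. *)
  exists (ln (c + expR (- c))); first by rewrite ln_gt0// mean_expR_factor_gt1.
  by move=> y' _; exact: log_partition_gap (ltW c0) cdev y'.
split; [exact: inj_of_gap gap|exact: penalty_of_gap gap].
Qed.
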